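(* Let $Y=C+E\in F^{L\times n}$ where $C$ is a codeword of the interleaved Reed--Solomon code, and suppose $E$ satisfies the partial-inverse condition. Then $\Lambda_E(x)$ is the unique (up to a scale factor) nonzero polynomial $\Lambda(x)\in F[x]$ of smallest degree such that $$\deg\big(S^{(i)}(x)\Lambda(x)\bmod\tilde m^{(i)}(x)\big)<\deg\Lambda(x)\quad\text{for all }i\in\{1,\ldots,L\},$$ and, equivalently, the unique (up to a scale factor) nonzero polynomial $\Lambda(x)\in F[x]$ of smallest degree such that $$\deg\big(\breve S^{(i)}(x)\Lambda(x)\bmod x^{n-k^{(i)}}\big)<\deg\Lambda(x)\quad\text{for all }i\in\{1,\ldots,L\}.$$
   Context: For polynomials, $\bmod$ denotes the remainder of polynomial division; the degree of the zero polynomial is $-\infty$; the coefficient of $x^d$ in a polynomial is denoted by the subscript $d$. Code: $F$ is a finite field, $\beta_0,\ldots,\beta_{n-1}$ are $n$ distinct elements of $F$ (one may be $0$), $m(x):=\prod_{\ell=0}^{n-1}(x-\beta_\ell)$, and $\psi:F[x]/m(x)\to F^n$, $a(x)\mapsto(a(\beta_0),\ldots,a(\beta_{n-1}))$, a ring isomorphism; $\psi^{-1}(v)$ is identified with the unique polynomial of degree less than $n$ whose values at $\beta_0,\ldots,\beta_{n-1}$ are the entries of $v$. Codewords are the arrays in $F^{L\times n}$ ($L\ge1$) whose $i$-th row $c^{(i)}$ satisfies $\deg\psi^{-1}(c^{(i)})<k^{(i)}$, $i=1,\ldots,L$, where $k^{(i)}$ is the dimension of the $i$-th row code. Let $k_{\max}:=\max_i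 k^{(i)}$; it is assumed that $k_{\max}<n$. Errors: for $E\in F^{L\times n}$ with rows $e^{(i)}$ and columns $e_0,\ldots,e_{n-1}$, put $E^{(i)}(x):=\psi^{-1}(e^{(i)})$, $U_E:=\{\ell:e_\ell\ne0\}$ and $\Lambda_E(x):=\prod_{\ell\in U_E}(x-\beta_\ell)$. For $Y$ with rows $y^{(i)}$, $Y^{(i)}(x):=\psi^{-1}(y^{(i)})$. SPI solution: a finite set of inequalities $\deg(b^{(i)}(x)\Lambda(x)\bmod m^{(i)}(x))<\tau^{(i)}$, $i=1,\ldots,L$ (with $\deg m^{(i)}\ge1$, $\deg b^{(i)}<\deg m^{(i)}$, $0\le\tau^{(i)}\le\deg m^{(i)}$), has an SPI solution, namely the nonzero polynomial $\Lambda(x)$ of smallest degree satisfying all of them; it exists and is unique up to a nonzero scale factor. Partial-inverse condition: $E$ satisfies it if $|U_E|\le n-k_{\max}$ and the SPI solution of $\deg(E^{(i)}(x)\Lambda(x)\bmod m(x))<k^{(i)}+|U_E|$, $i=1,\ldots,L$, is $\Lambda_E(x)$ (up to a nonzero scale factor). Syndromes: $S^{(i)}(x):=Y^{(i)}_{k^{(i)}}+Y^{(i)}_{k^{(i)}+1}x+\cdots+Y^{(i)}_{n-1}x^{n-k^{(i)}-1}$ and $\tilde m^{(i)}(x):=m_{k^{(i)}}+m_{k^{(i)}+1}x+\cdots+m_nx^{n-k^{(i)}}$. Monomialized syndromes: let $\overline S^{(i)}(x):=x^{n-k^{(i)}-1}S^{(i)}(x^{-1})$, $\overline m^{(i)}(x):=x^{n-k^{(i)}}\tilde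 m^{(i)}(x^{-1})$, let $w^{(i)}(x)$ be the inverse of $\overline m^{(i)}(x)$ in $F[x]/x^{n-k^{(i)}}$, let $s^{(i)}(x):=w^{(i)}(x)\overline S^{(i)}(x)\bmod x^{n-k^{(i)}}$, and $\breve S^{(i)}(x):=x^{n-k^{(i)}-1}s^{(i)}(x^{-1})$. *)

(* Defs.v *)
From mathcomp Require Import all_boot all_order all_algebra.

Set Implicit Arguments.
Unset Strict Implicit.
Unset Printing Implicit Defensive.

Import GRing.Theory.
Local Open Scope ring_scope.

(* Degrees are expressed through [size]: [size p] is deg p + 1 for p != 0 and
   size 0 = 0.  With the convention deg 0 = -oo, the inequality deg p < t
   (t : nat) is [size p <= t], and deg p < deg q with q != 0 is
   [size p < size q]. *)

Definition min_degree (F : fieldType) (P : {poly F} -> Prop) (p : {poly F}) :=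
  [/\ p != 0, P p & forall q, q != 0 -> P q -> (size p <= size q)%N].

(* Over a field, [q %= p] says that q is a nonzero scalar multiple of p. *)
Definition unique_min_degree (F : fieldType) (P : {poly F} -> Prop)
    (p : {poly F}) :=
  min_degree P p /\ forall q, min_degree P q -> q %= p.

Definition spi_solution (F : fieldType) (L : nat) (b m : 'I_L -> {poly F})
    (tau : 'I_L -> nat) : {poly F} -> Prop :=
  min_degree (fun p => forall i, (size ((b i * p) %% m i)%R <= tau i)%N).

Lemma spi_solution_unique (F : fieldType) (L : nat) (b m : 'I_L -> {poly F})
    (tau : 'I_L -> nat) (p q : {poly F}) :
  spi_solution b m tau p -> spi_solution b m tau q -> q %= p.
Proof.
move=> [p0 Pp minp] [q0 Pq minq].
have spq : size p = size q by apply/eqP; rewrite eqn_leq minp // minq.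
pose r := lead_coef q *: p - lead_coef p *: q.
have r_lt : (size r < size p)%N.
  rewrite -(prednK (n := size p)) ?size_poly_gt0 // ltnS.
  apply/leq_sizeP => j; rewrite leq_eqVlt => /orP[/eqP <-|jp].
    by rewrite coefB !coefZ {2}spq -!lead_coefE mulrC subrr.
  have pj : (size p <= j)%N.
    by rewrite -(prednK (n := size p)) ?size_poly_gt0.
  by rewrite coefB !coefZ !nth_default ?mulr0 ?subr0 // -spq.
have Pr i : (size ((b i * r) %% m i)%R <= tau i)%N.
  rewrite mulrBr -!scalerAr modpD modpN !modpZl.
  rewrite (leq_trans (size_polyD _ _)) // geq_max size_polyN.
  by rewrite !(leq_trans (size_scale_leq _ _)).
have r0 : r = 0.
  apply/eqP; apply: contraTT r_lt => r0; rewrite -leqNgt; exact: minp.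
apply/eqpP; exists (lead_coef p, lead_coef q).
  by rewrite /= !lead_coef_eq0 p0 q0.
by apply/esym/eqP; rewrite -subr_eq0; apply/eqP.
Qed.

Definition code_locator (F : fieldType) (n : nat) (beta : 'I_n -> F) :
    {poly F} := \prod_(l < n) ('X - (beta l)%:P).

(* The inverse of a |-> (a(beta_0), ..., a(beta_(n-1))) on polynomials of
   degree less than n, by Lagrange interpolation. *)
Definition psi_inv (F : fieldType) (n : nat) (beta : 'I_n -> F)
    (v : 'rV[F]_n) : {poly F} :=
  \sum_(l < n) v 0 l *:
    \prod_(j < n | j != l) ((beta l - beta j)^-1 *: ('X - (beta j)%:P)).

Lemma size_psi_inv (F : fieldType) (n : nat) (beta : 'I_n -> F)
    (v : 'rV[F]_n) : (size (psi_inv beta v) <= n)%N.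
Proof.
apply: (leq_trans (size_sum _ _ _)); apply/bigmax_leqP => l _.
apply: (leq_trans (size_scale_leq _ _)).
apply: (leq_trans (size_poly_prod_leq _ _)).
have le_sum : (\sum_(j < n | j != l)
    size ((beta l - beta j)^-1 *: ('X - (beta j)%:P))%R
      <= \sum_(j < n | j != l) 2)%N.
  apply: leq_sum => j _; apply: (leq_trans (size_scale_leq _ _)).
  by rewrite size_XsubC.
rewrite sum_nat_const in le_sum.
have card_l : #|[pred j : 'I_n | j != l]| = n.-1.
  by rewrite cardC1 card_ord.
rewrite card_l in le_sum *.
rewrite leq_subLR; apply: (leq_ltn_trans le_sum).
by case: n l {v le_sum card_l beta} => [[]|n l] //=; rewrite muln2 -addnn addnS.
Qed.

Lemma horner_psi_inv (F : fieldType) (n : nat) (beta : 'I_n -> F)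
    (v : 'rV[F]_n) (l : 'I_n) :
  injective beta -> (psi_inv beta v).[beta l] = v 0 l.
Proof.
move=> inj; rewrite horner_sum (bigD1 l) //= [X in _ + X]big1 ?addr0.
  rewrite hornerZ horner_prod big1 ?mulr1 // => j jl.
  rewrite !hornerE mulVf // subr_eq0; apply: contra jl => /eqP/inj ->.
  exact: eqxx.
move=> i il; rewrite hornerZ horner_prod (bigD1 l) 1?eq_sym //=.
by rewrite !hornerE subrr /= mulr0 mul0r.
Qed.

Lemma psi_inv_unique (F : fieldType) (n : nat) (beta : 'I_n -> F)
    (a : {poly F}) :
  injective beta -> (size a <= n)%N ->
  psi_inv beta (\row_l a.[beta l]) = a.
Proof.
move=> inj sa; apply/eqP; rewrite -subr_eq0; apply/eqP.
apply: (@roots_geq_poly_eq0 _ _ (codom beta)).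
- apply/allP => _ /codomP[l ->].
  by rewrite /root hornerD hornerN horner_psi_inv // mxE subrr.
- by apply/injectiveP.
- rewrite size_codom card_ord (leq_trans (size_polyD _ _)) //.
  by rewrite geq_max size_polyN sa size_psi_inv.
Qed.

Definition codeword (F : fieldType) (L n : nat) (beta : 'I_n -> F)
    (k : 'I_L -> nat) (C : 'M[F]_(L, n)) : Prop :=
  forall i, (size (psi_inv beta (row i C)) <= k i)%N.

Definition kmax (L : nat) (k : 'I_L -> nat) : nat := \max_(i < L) k i.

Definition error_support (F : fieldType) (L n : nat) (E : 'M[F]_(L, n)) :
    {set 'I_n} := [set l | col l E != 0].

Definition error_locator (F : fieldType) (L n : nat) (beta : 'I_n -> F)
    (E : 'M[F]_(L, n)) : {poly F} :=
  \prod_(l in error_support E) ('X - (beta l)%:P).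

Definition partial_inverse_condition (F : fieldType) (L n : nat)
    (beta : 'I_n -> F) (k : 'I_L -> nat) (E : 'M[F]_(L, n)) : Prop :=
  (#|error_support E| <= n - kmax k)%N /\
  exists2 p : {poly F},
    spi_solution (fun i => psi_inv beta (row i E))
                 (fun=> code_locator beta)
                 (fun i => (k i + #|error_support E|)%N) p
    & p %= error_locator beta E.

Definition syndrome (F : fieldType) (L n : nat) (beta : 'I_n -> F)
    (k : 'I_L -> nat) (Y : 'M[F]_(L, n)) (i : 'I_L) : {poly F} :=
  \poly_(j < n - k i) (psi_inv beta (row i Y))`_(k i + j).

Definition mtilde (F : fieldType) (L n : nat) (beta : 'I_n -> F)
    (k : 'I_L -> nat) (i : 'I_L) : {poly F} :=
  \poly_(j < (n - k i).+1) (code_locator beta)`_(k i + j).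

(* x^d p(1/x), for p of degree at most d. *)
Definition reverse_poly (F : fieldType) (d : nat) (p : {poly F}) : {poly F} :=
  \poly_(j < d.+1) p`_(d - j).

(* The inverse of p in F[x]/x^N, as a polynomial of degree less than N; it is
   meaningful only for 0 < N and p(0) != 0. *)
Definition inv_modXn (F : fieldType) (N : nat) (p : {poly F}) : {poly F} :=
  (in_qpoly 'X^N p)^-1.

Lemma inv_modXnP (F : fieldType) (N : nat) (p : {poly F}) :
  (0 < N)%N -> p`_0 != 0 -> (inv_modXn N p * p) %% 'X^N = 1.
Proof.
move=> N0 p0; have qE : mk_monic 'X^N = 'X^N :> {poly F}.
  by rewrite mk_monic_Xn prednK.
have inE : in_qpoly 'X^N p = p %% 'X^N :> {poly F}.
  by rewrite /= qE -Pdiv.IdomainMonic.modpE ?monicXn.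
have cop : coprimep (mk_monic 'X^N) (in_qpoly 'X^N p).
  rewrite inE qE coprimep_modr coprimep_pexpl // coprimep_sym.
  by rewrite -['X]subr0 coprimep_XsubC /root horner_coef0.
have : (in_qpoly 'X^N p)^-1 * in_qpoly 'X^N p = 1 := qpoly_mulVz cop.
move=> /(congr1 val) inv1; rewrite -[RHS]inv1 [RHS]poly_of_qpolyM.
rewrite -[X in (X * _) %% _]/(polyn (in_qpoly 'X^N p)^-1).
move: (polyn _^-1) (inE) => w ->.
by rewrite qE -Pdiv.IdomainMonic.modpE ?monicXn // modp_mul.
Qed.

Definition mono_syndrome (F : fieldType) (L n : nat) (beta : 'I_n -> F)
    (k : 'I_L -> nat) (Y : 'M[F]_(L, n)) (i : 'I_L) : {poly F} :=
  let N := (n - k i)%N in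
  let Sbar := reverse_poly N.-1 (syndrome beta k Y i) in
  let mbar := reverse_poly N (mtilde beta k i) in
  let s := (inv_modXn N mbar * Sbar) %% 'X^N in
  reverse_poly N.-1 s.

(* Main.v *)
Require Import Defs.
From mathcomp Require Import all_boot all_order all_algebra.
From mathcomp Require Import zify.

Set Implicit Arguments.
Unset Strict Implicit.
Unset Printing Implicit Defensive.

Import GRing.Theory.
Local Open Scope ring_scope.

(* Write d for deg p and suppose k_i + d <= n. Then
   deg (S_i p mod mtilde_i) < d iff S_i p - q mtilde_i has degree < d for some
   q with deg q < d; multiplying by x^(k_i) and restoring the low-order
   coefficients of Y_i and m, whose contributions have degree < k_i + d, turns
   this into deg (Y_i p mod m) < k_i + d. The codeword row contributes degree
   < k_i + d too, so Y_i may be replaced by E_i. As E_i Lambda_E = 0 mod m,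
   Lambda_E satisfies the inequalities, while a solution of degree at most
   |U_E| satisfies those of the partial-inverse condition, whose minimal
   solution is Lambda_E. For monomialized syndromes, reversing S_i p - q M
   turns the key equation into a congruence modulo x^(n - k_i), and the reversed
   monomialized syndrome s_i is the reversed syndrome divided by the reversed
   mtilde_i, so the congruences for (S_i, mtilde_i) and (s_i, 1) agree. *)

(** * Degree bounds, reversal of polynomials, and key equations *)

Lemma size_mul_leq_add (R : idomainType) (p q : {poly R}) (a b : nat) :
  (size p <= a)%N -> (size q <= b.+1)%N -> (size (p * q)%R <= a + b)%N.
Proof.
by move=> pa qb; apply: leq_trans (size_polyMleq _ _) _; lia.
Qed.

(* x^(n-1) p(1/x); indexing by a bound on the size rather than on the degree
   makes n = 0 meaningful. *)
Definition rev_size (R : nzRingType) (n : nat) (p : {poly R}) : {poly R} :=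
  \poly_(j < n) p`_(n.-1 - j).

Lemma rev_sizeE (R : nzRingType) n (p : {poly R}) :
  rev_size n p = \sum_(j < n) p`_j *: 'X^(n.-1 - j).
Proof.
rewrite /rev_size poly_def (reindex_inj rev_ord_inj) /=.
apply: eq_bigr => j _; congr (_ `_ _ *: 'X^_); have := ltn_ord j; lia.
Qed.

Lemma rev_sizeB (R : nzRingType) n (p q : {poly R}) :
  rev_size n (p - q) = rev_size n p - rev_size n q.
Proof. by apply/polyP => j; rewrite !(coefB, coef_poly); case: ifP; rewrite ?subr0. Qed.

Lemma rev_sizeK (R : nzRingType) n (p : {poly R}) :
  (size p <= n)%N -> rev_size n (rev_size n p) = p.
Proof.
move=> sp; apply/polyP => j; rewrite !coef_poly.
case: ltnP => jn; last by rewrite nth_default // (leq_trans sp).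
by rewrite ifT; [congr (_ `_ _); lia | lia].
Qed.

Lemma rev_sizeXn (R : nzRingType) n : rev_size n.+1 'X^n = 1 :> {poly R}.
Proof.
apply/polyP => j; rewrite coef_poly coefXn coef1 /=; case: ltnP => jn.
  by congr (_%:R); lia.
by have -> : (j == 0)%N = false by lia.
Qed.

(** Reversal is linear, so it suffices to compare monomials, where [(a.-1 - i) + (b - j) = (a +
    b).-1 - (i + j)]. The sizes are asymmetric because a product of sizes [a] and [b.+1] has size at
    most [a + b]. *)
Lemma rev_sizeM (R : comNzRingType) a b (p q : {poly R}) :
  (size p <= a)%N -> (size q <= b.+1)%N ->
  rev_size (a + b) (p * q) = rev_size a p * rev_size b.+1 q.
Proof.
move=> pa qb.
have rev_sum (I : finType) n (f : I -> {poly R}) :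
    rev_size n (\sum_i f i) = \sum_i rev_size n (f i).
  apply/polyP => j; rewrite coef_sum coef_poly coef_sum.
  under [RHS]eq_bigr do rewrite coef_poly.
  by case: ifP => // _; rewrite big1.
have revXn n c i : (i < n)%N ->
    rev_size n (c *: 'X^i) = c *: 'X^(n.-1 - i) :> {poly R}.
  move=> ltin; rewrite rev_sizeE (bigD1 (Ordinal ltin)) //=.
  rewrite coefZ coefXn eqxx mulr1 big1 ?addr0 // => j ji.
  have -> : (c *: 'X^i)`_j = 0 :> R; last by rewrite scale0r.
  by rewrite coefZ coefXn (negPf (ji : (j : nat) != i)) mulr0.
have polyE n (r : {poly R}) : (size r <= n)%N -> r = \sum_(i < n) r`_i *: 'X^i.
  move=> rn; rewrite -poly_def; apply/polyP => j; rewrite coef_poly.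
  by case: ltnP => // nj; rewrite nth_default // (leq_trans rn).
rewrite {1}(polyE _ _ pa) {1}(polyE _ _ qb) mulr_suml rev_sum.
rewrite !rev_sizeE mulr_suml; apply: eq_bigr => i _.
rewrite !mulr_sumr rev_sum; apply: eq_bigr => j _.
have ia := ltn_ord i; have jb := ltn_ord j.
rewrite -!scalerAr -!scalerAl !scalerA -!exprD revXn; last by lia.
by congr (_ *: 'X^_); rewrite /=; lia.
Qed.

(** Reversal moves the top [N] of the [N + d] coefficients of [r] to the bottom, and both sides say
    that these vanish. *)
Lemma dvd_Xn_rev_size (F : fieldType) N d (r : {poly F}) :
  (size r <= N + d)%N -> ('X^N %| rev_size (N + d) r) = (size r <= d)%N.
Proof.
move=> rNd.
apply/idP/idP => [/dvdpP[c cE]|rd].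
  apply/leq_sizeP => j dj.
  case: (ltnP j (N + d)) => jNd; last by rewrite nth_default // (leq_trans rNd).
  have /(congr1 (fun p : {poly F} => p`_((N + d).-1 - j))) := cE.
  rewrite /rev_size coef_poly coefMXn !ifT; [|lia|lia].
  by move=> rj; rewrite -[RHS]rj; congr (_ `_ _); lia.
apply/dvdpP; exists (rev_size d r); apply/polyP => j.
rewrite coefMXn !coef_poly; case: (ltnP j N) => jN.
  by rewrite nth_default ?if_same // (leq_trans rd) //; lia.
have -> : (j < N + d)%N = (j - N < d)%N by lia.
by case: ifP => // jd; congr (_ `_ _); lia.
Qed.

(** The division quotient has size at most [(N + d) - N = d]. Conversely, a difference of size at
    most [t <= N < size M] is already the remainder. *)
Lemma size_modp_leqP (F : fieldType) (N d t : nat) (S M p : {poly F}) :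
  (size S <= N)%N -> size M = N.+1 -> (size p <= d.+1)%N -> (t <= N)%N ->
  (size ((S * p) %% M)%R <= t)%N <->
  exists2 q : {poly F}, (size q <= d)%N & (size (S * p - q * M)%R <= t)%N.
Proof.
move=> SN MN pd tN; have M0 : M != 0 by rewrite -size_poly_gt0 MN.
split=> [rt|[q qd rt]].
  exists ((S * p) %/ M); last by rewrite {1}(divp_eq (S * p) M) addrC addKr.
  by rewrite size_divp // MN leq_subLR size_mul_leq_add.
have -> : S * p = q * M + (S * p - q * M) by rewrite addrC subrK.
by rewrite modp_addl_mul_small // MN ltnS (leq_trans rt).
Qed.

(* Reversal turns the key equation [S p = q M + r] with [size r <= d] into a
   congruence modulo x^N. *)
Lemma size_modp_revP (F : fieldType) (N d : nat) (S M p : {poly F}) :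
  (size S <= N)%N -> size M = N.+1 -> (size p <= d.+1)%N -> (d <= N)%N ->
  (size ((S * p) %% M)%R <= d)%N <->
  exists2 q : {poly F}, (size q <= d)%N &
    'X^N %| rev_size N S * rev_size d.+1 p - q * rev_size N.+1 M.
Proof.
move=> SN MN pd dN; have MN' : (size M <= N.+1)%N by rewrite MN.
have revE (q : {poly F}) : (size q <= d)%N ->
    ('X^N %| rev_size N S * rev_size d.+1 p - rev_size d q * rev_size N.+1 M)
    = (size (S * p - q * M)%R <= d)%N.
  (* Both products have size at most [N + d], so they can be reversed at this common size and
     subtracted. *)
  move=> qd; rewrite -!rev_sizeM // [(d + N)%N]addnC -rev_sizeB.
  apply: dvd_Xn_rev_size; apply: leq_trans (size_polyD _ _) _.
  rewrite size_polyN geq_max size_mul_leq_add //=.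
  by rewrite addnC size_mul_leq_add.
have revd (q : {poly F}) : (size (rev_size d q) <= d)%N by apply: size_poly.
split=> [/(size_modp_leqP SN MN pd dN)[q qd rd]|[q qd rd]].
  by exists (rev_size d q); rewrite ?revE.
apply/(size_modp_leqP SN MN pd dN); exists (rev_size d q) => //.
by rewrite -revE // rev_sizeK.
Qed.

(** * Code locator and error locator *)

Lemma psi_invD (F : fieldType) n (beta : 'I_n -> F) (u v : 'rV[F]_n) :
  psi_inv beta (u + v) = psi_inv beta u + psi_inv beta v.
Proof.
by rewrite -big_split; apply: eq_bigr => l _; rewrite mxE scalerDl.
Qed.

Lemma size_code_locator (F : fieldType) n (beta : 'I_n -> F) :
  size (code_locator beta) = n.+1.
Proof. by rewrite size_prod_XsubC /index_enum -enumT size_enum_ord. Qed.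

Lemma code_locator_lead (F : fieldType) n (beta : 'I_n -> F) :
  (code_locator beta)`_n = 1.
Proof.
have /monicP := monic_prod_XsubC (index_enum 'I_n) xpredT beta.
by rewrite lead_coefE -/(code_locator beta) size_code_locator.
Qed.

Lemma size_error_locator (F : fieldType) L n (beta : 'I_n -> F)
    (E : 'M[F]_(L, n)) :
  size (error_locator beta E) = #|error_support E|.+1.
Proof. by rewrite /error_locator -big_enum size_prod_XsubC -cardE. Qed.

(** The product vanishes at every [beta l]: through the locator if [l] is an error position, through
    the zero entry of the error row otherwise. *)
Lemma code_locator_dvd_error (F : fieldType) L n (beta : 'I_n -> F)
    (E : 'M[F]_(L, n)) i : injective beta ->
  code_locator beta %| psi_inv beta (row i E) * error_locator beta E.
Proof.
move=> inj; have -> : code_locator beta = \prod_(z <- codom beta) ('X - z%:P).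
  by rewrite /codom /image_mem big_map big_enum.
apply: uniq_roots_dvdp; last by rewrite uniq_rootsE; apply/injectiveP.
apply/allP => _ /codomP[l ->]; rewrite rootM.
have [lU|lU] := boolP (l \in error_support E).
  apply/orP; right; rewrite /error_locator (bigD1 l) //= rootM.
  by rewrite root_XsubC eqxx.
apply/orP; left; rewrite /root horner_psi_inv // mxE.
move: lU; rewrite inE negbK => /eqP/matrixP/(_ i 0).
by rewrite !mxE => ->.
Qed.

(** * Key equations for syndromes and monomialized syndromes *)

Section Syndromes.

Variables (F : fieldType) (L n : nat) (beta : 'I_n -> F) (k : 'I_L -> nat).
Variables (Y : 'M[F]_(L, n)) (i : 'I_L).
Hypothesis kn : (k i < n)%N.

Let N := (n - k i)%N.

Lemma mtildeE : mtilde beta k i = drop_poly (k i) (code_locator beta).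
Proof.
apply/polyP => j; rewrite coef_poly coef_drop_poly addnC.
by case: ltnP => // jn; rewrite nth_default // size_code_locator; lia.
Qed.

Lemma syndromeE : syndrome beta k Y i = drop_poly (k i) (psi_inv beta (row i Y)).
Proof.
apply/polyP => j; rewrite coef_poly coef_drop_poly addnC.
case: ltnP => // jn; rewrite nth_default //.
by apply: leq_trans (size_psi_inv _ _) _; lia.
Qed.

Lemma size_mtilde : size (mtilde beta k i) = N.+1.
Proof. by rewrite mtildeE size_drop_poly size_code_locator subSn // ltnW. Qed.

Lemma size_syndrome : (size (syndrome beta k Y i) <= N)%N.
Proof. exact: size_poly. Qed.

(** Both conditions become the existence of a quotient of size at most [d], and the same quotient
    serves for both. *)
Lemma size_syndrome_modP d (p : {poly F}) :
  (size p <= d.+1)%N -> (d <= N)%N ->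
  (size ((syndrome beta k Y i * p) %% mtilde beta k i)%R <= d)%N <->
  (size ((psi_inv beta (row i Y) * p) %% code_locator beta)%R <= k i + d)%N.
Proof.
move=> pd dN; have kdn : (k i + d <= n)%N by rewrite /N in dN; lia.
have dropE (q : {poly F}) : (size q <= d)%N ->
    (size (syndrome beta k Y i * p - q * mtilde beta k i)%R <= d)%N =
    (size (psi_inv beta (row i Y) * p - q * code_locator beta)%R <= k i + d)%N.
  move=> qd; rewrite syndromeE mtildeE.
  set y := psi_inv _ _; set m := code_locator _.
  set r := _ - _; set z := _ - _ * m.
  (* The part of [z] lost by dropping the low coefficients of [y] and [m]; each of its two products
     has size at most [k i + d]. *)
  pose low := take_poly (k i) y * p - q * take_poly (k i) m.
  have low_size : (size low <= k i + d)%N.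
    apply: leq_trans (size_polyD _ _) _; rewrite size_polyN geq_max.
    rewrite size_mul_leq_add ?size_take_poly //= addnC.
    by rewrite size_mul_leq_add // (leq_trans (size_take_poly _ _)).
  have zE : z = low + r * 'X^(k i).
    rewrite /z -{1}(poly_take_drop (k i) y) -{1}(poly_take_drop (k i) m).
    rewrite /low /r mulrDl mulrDr mulrBl opprD !mulrA.
    by rewrite [drop_poly _ _ * _ * p]mulrAC addrACA.
  have XE : (size (r * 'X^(k i))%R <= k i + d)%N = (size r <= d)%N.
    have [->|r0] := eqVneq r 0; first by rewrite mul0r size_poly0.
    by rewrite size_mulXn // leq_add2l.
  rewrite -XE; apply/idP/idP => h.
    by rewrite zE (leq_trans (size_polyD _ _)) // geq_max low_size.
  have -> : r * 'X^(k i) = z - low by rewrite zE addrC addKr.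
  by rewrite (leq_trans (size_polyD _ _)) // size_polyN geq_max low_size h.
have A := size_modp_leqP size_syndrome size_mtilde pd dN.
have B := size_modp_leqP (size_psi_inv beta (row i Y))
  (size_code_locator beta) pd kdn.
split=> [/A[q qd h]|/B[q qd h]]; [apply/B|apply/A]; exists q => //.
  by rewrite -dropE.
by rewrite dropE.
Qed.

Lemma size_mono_syndrome_modP d (p : {poly F}) :
  (size p <= d.+1)%N -> (d <= N)%N ->
  (size ((mono_syndrome beta k Y i * p) %% 'X^N)%R <= d)%N <->
  (size ((syndrome beta k Y i * p) %% mtilde beta k i)%R <= d)%N.
Proof.
move=> pd dN; have N0 : (0 < N)%N by rewrite subn_gt0.
have revN (q : {poly F}) : reverse_poly N.-1 q = rev_size N q.
  by rewrite /reverse_poly /rev_size prednK.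
rewrite /mono_syndrome -/N !revN.
rewrite -[reverse_poly N _]/(rev_size N.+1 _).
set mbar := rev_size N.+1 _; set S := syndrome _ _ _ _.
set s := (_ * rev_size N S) %% _.
(* The constant term of [mbar] is the leading coefficient of the code locator, so [mbar] is a unit
   modulo ['X^N]. *)
have mbar0 : mbar`_0 != 0.
  rewrite coef_poly /= subn0 coef_poly ltnSn subnKC ?code_locator_lead //.
    exact: oner_neq0.
  exact: ltnW.
have s_size : (size s <= N)%N.
  by rewrite -ltnS -(size_polyXn F N) ltn_modp -size_poly_gt0 size_polyXn.
have smbar : 'X^N %| s * mbar - rev_size N S.
  apply/modp_eq0P; rewrite modpD modpN /s; set w := inv_modXn N mbar.
  rewrite [_ * mbar]mulrC modp_mul mulrCA mulrA [w * mbar * _]mulrC -modp_mul.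
  by rewrite inv_modXnP // mulr1 subrr.
have cop : coprimep 'X^N mbar.
  by rewrite coprimep_pexpl // coprimep_sym -['X]subr0 coprimep_XsubC /root horner_coef0.
have A := size_modp_revP (size_poly N _ : size (rev_size N s) <= N)%N
  (size_polyXn F N) pd dN.
have B := size_modp_revP size_syndrome size_mtilde pd dN.
(* Reversing the monomialized syndrome gives back [s], and the modulus ['X^N] reverses to 1. *)
rewrite (rev_sizeK s_size) rev_sizeXn in A.
have congE q : ('X^N %| s * rev_size d.+1 p - q * 1) =
    ('X^N %| rev_size N S * rev_size d.+1 p - q * mbar).
  (* Multiplying by [mbar], coprime to ['X^N], preserves divisibility both ways and turns [s] into
     the reversed syndrome. *)
  rewrite mulr1 -(Gauss_dvdpr _ cop).
  have -> : mbar * (s * rev_size d.+1 p - q) =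
    (s * mbar - rev_size N S) * rev_size d.+1 p +
    (rev_size N S * rev_size d.+1 p - q * mbar).
    rewrite mulrBr mulrBl addrA subrK mulrA.
    by rewrite [mbar * s]mulrC [mbar * q]mulrC.
  by rewrite dvdp_addr // dvdp_mulr.
split=> [/A[q qd h]|/B[q qd h]]; [apply/B|apply/A]; exists q => //.
  by rewrite -congE.
by rewrite congE.
Qed.

End Syndromes.

(** * Minimality and uniqueness of the error locator *)

Section ErrorLocator.

Variables (F : fieldType) (L n : nat) (beta : 'I_n -> F) (k : 'I_L -> nat).
Variable E : 'M[F]_(L, n).
Hypothesis PI : partial_inverse_condition beta k E.
Hypothesis beta_inj : injective beta.

(** Abstracting over [P] covers both kinds of syndromes. Knowing [P] up to degree [n - kmax k]
    suffices, since only polynomials of degree at most [|U_E| <= n - kmax k] compete. *)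
Lemma unique_min_degree_error_locator (P : {poly F} -> Prop) :
  (forall p : {poly F}, p != 0 -> ((size p).-1 <= n - kmax k)%N ->
     P p <-> forall i, (size ((psi_inv beta (row i E) * p)
       %% code_locator beta)%R <= k i + (size p).-1)%N) ->
  unique_min_degree P (error_locator beta E).
Proof.
move=> PE; have [cardU [p spi_p pE]] := PI; have [p0 Pp minp] := spi_p.
have sp : size p = #|error_support E|.+1.
  by rewrite (eqp_size pE) size_error_locator.
have L0 : error_locator beta E != 0.
  by rewrite -size_poly_gt0 size_error_locator.
have spi_q (q : {poly F}) : q != 0 -> ((size q).-1 <= #|error_support E|)%N -> P q ->
    forall i, (size ((psi_inv beta (row i E) * q) %% code_locator beta)%R
      <= k i + #|error_support E|)%N.
  move=> q0 qU /PE h i; apply: leq_trans (h q0 (leq_trans qU cardU) i) _.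
  by rewrite leq_add2l.
have minL : min_degree P (error_locator beta E).
  split=> // [|q q0 Pq].
    apply/PE; rewrite ?size_error_locator // => i.
    have /modp_eq0P -> := code_locator_dvd_error E i beta_inj.
    by rewrite size_poly0.
  rewrite size_error_locator leqNgt; apply/negP => qU.
  have qU' : ((size q).-1 <= #|error_support E|)%N by lia.
  by have := minp q q0 (spi_q q q0 qU' Pq); rewrite sp leqNgt qU.
split=> // q [q0 Pq minq]; have [_ PL minLq] := minL.
(* Any minimal [q] has the degree of the error locator, hence is itself an SPI solution, and these
   are unique up to scale. *)
have sq : size q = #|error_support E|.+1.
  rewrite -(size_error_locator beta E).
  by apply/eqP; rewrite eqn_leq minq // minLq.
apply: eqp_trans pE; apply: spi_solution_unique spi_p _.
split=> // [i|r r0 Pr]; first by apply: spi_q => //; rewrite sq.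
by rewrite sq -sp; apply: minp.
Qed.

End ErrorLocator.

Theorem proposition8 (F : finFieldType) (L n : nat) (beta : 'I_n -> F)
    (k : 'I_L -> nat) (C E Y : 'M[F]_(L, n))
    (L_gt0 : (0 < L)%N) (beta_inj : injective beta) (kmax_lt : (kmax k < n)%N)
    (YE : Y = C + E) (Ccode : codeword beta k C)
    (PI : partial_inverse_condition beta k E) :
  unique_min_degree
    (fun p : {poly F} => forall i : 'I_L,
       (size ((syndrome beta k Y i * p) %% mtilde beta k i)%R < size p)%N)
    (error_locator beta E)
  /\
  unique_min_degree
    (fun p : {poly F} => forall i : 'I_L,
       (size ((mono_syndrome beta k Y i * p) %% 'X^(n - k i))%R < size p)%N)
    (error_locator beta E).
Proof.
have ki i : (k i <= kmax k)%N by apply: leq_bigmax.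
have kn i : (k i < n)%N by apply: leq_ltn_trans kmax_lt.
have ltE (p : {poly F}) (a : nat) : p != 0 -> (a < size p)%N = (a <= (size p).-1)%N.
  by move=> p0; rewrite {1}(polySpred p0) ltnS.
have sizeE (p : {poly F}) : (size p <= (size p).-1.+1)%N by apply: leqSpred.
have keyE (p : {poly F}) i : p != 0 -> ((size p).-1 <= n - kmax k)%N ->
    (size ((syndrome beta k Y i * p) %% mtilde beta k i)%R < size p)%N <->
    (size ((psi_inv beta (row i E) * p) %% code_locator beta)%R
      <= k i + (size p).-1)%N.
  move=> p0 pn; have dN : ((size p).-1 <= n - k i)%N by have := ki i; lia.
  rewrite ltE //.
  apply: (iff_trans (size_syndrome_modP beta Y (kn i) (sizeE p) dN)).
  have Cp := size_mul_leq_add (Ccode i) (sizeE p).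
  (* The product has degree below [k i + deg p <= n], so it is its own remainder and only shifts the
     remainder for [E] within the allowed bound. *)
  have Cmod : (psi_inv beta (row i C) * p) %% code_locator beta =
      psi_inv beta (row i C) * p.
    apply: modp_small; rewrite size_code_locator ltnS (leq_trans Cp) //.
    by have := ki i; lia.
  have -> : row i Y = row i C + row i E by rewrite YE raddfD.
  rewrite psi_invD mulrDl modpD Cmod; split=> h.
    set e := _ %% _ in h *.
    rewrite -(addKr (psi_inv beta (row i C) * p) e).
    by rewrite (leq_trans (size_polyD _ _)) // size_polyN geq_max Cp h.
  by rewrite (leq_trans (size_polyD _ _)) // geq_max Cp h.
split; apply: (unique_min_degree_error_locator PI beta_inj) => // p p0 pn.
  by split=> h i; apply/(keyE p i p0 pn).
have monoE i := size_mono_syndrome_modP beta Y (kn i) (sizeE p)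
  (leq_trans pn (leq_sub2l n (ki i))).
split=> h i; first by apply/(keyE p i p0 pn); rewrite ltE //; apply/monoE; rewrite -ltE.
by rewrite ltE //; apply/monoE; rewrite -ltE //; apply/(keyE p i p0 pn).
Qed.
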